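(* For $s-q\ge 1$, the $\Gamma$-bound and the spectral bound for the Data-Fusion problem satisfy $\mathfrak{z}_{\Gamma}\le\mathfrak{z}_{\mathcal{S}}$.
   Context: Let $G\in\mathbb{R}^{p\times m}$, $H\in\mathbb{R}^{q\times m}$, $B:=H^\top H$ positive definite, $P:=\{1,\dots,p\}$, and $s$ an integer with $0<s-q<p$. The Data-Fusion problem is $\max\{\operatorname{ldet}(B+G^\top\operatorname{Diag}(x)G):\mathbf{e}^\top x=s-q,\ x\in\{0,1\}^p\}$, where $\operatorname{ldet}$ is log-determinant, $\mathbf{e}$ the all-ones vector, $\operatorname{Diag}(x)$ the diagonal matrix with diagonal $x$. $\lambda_i(X)$ denotes the $i$-th largest eigenvalue of a symmetric matrix $X$. The $\Gamma$-function: for $\lambda\in\mathbb{R}_+^k$ with $\lambda_1\ge\dots\ge\lambda_k$ and an integer $t$ with $0<t\le k$, there is a unique integer $\iota$ with $0\le\iota<t$ such that $\lambda_\iota>\frac{1}{t-\iota}\sum_{\ell=\iota+1}^k\lambda_\ell\ge\lambda_{\iota+1}$, with the convention $\lambda_0=+\infty$. Define $\phi_t(\lambda):=\sum_{\ell=1}^{\iota}\log(\lambda_\ell)+(t-\iota)\log\big(\frac{1}{t-\iota}\sum_{\ell=\iota+1}^k\lambda_\ell\big)$, with $\log(0)=-\infty$. For a symmetric positive-semidefinite $k\times k$ matrix $X$, $\Gamma_t(X):=\phi_t(\lambda(X))$, where $\lambda(X)$ is the vector of eigenvalues of $X$ in nonincreasing order. $\Gamma$-bound: let $\Psi\Psi^\top$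 be the Cholesky factorization of $I_p+GB^{-1}G^\top$ and $\psi_i^\top$ the $i$-th row of $\Psi$, $i\in P$. Then $$\mathfrak{z}_{\Gamma}:=\operatorname{ldet}(B)+\max\Big\{\Gamma_{s-q}\Big(\sum_{i\in P}z_i\psi_i\psi_i^\top\Big):\mathbf{e}^\top z=s-q,\ 0\le z_i\le1\ (i\in P)\Big\}.$$ Spectral bound: $\mathfrak{z}_{\mathcal{S}}:=\operatorname{ldet}(B)+\sum_{i=1}^{s-q}\log\big(1+\lambda_i(GB^{-1}G^\top)\big)$. *)

(* Defs.v *)
From HB Require Import structures.
From mathcomp Require Import all_boot all_order all_algebra.
From mathcomp Require Import all_classical all_reals ereal exp.
From mathcomp Require Import complex.

Set Implicit Arguments.
Unset Strict Implicit.
Unset Printing Implicit Defensive.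

Import Order.TTheory GRing.Theory Num.Theory.

Local Open Scope classical_set_scope.
Local Open Scope ring_scope.

Definition posdef (R : realType) (n : nat) (A : 'M[R]_n) : Prop :=
  A^T = A /\ forall x : 'cV[R]_n, x != 0 -> 0 < (x^T *m A *m x) 0 0.

(* [is_trig_mx] is MathComp's predicate for lower triangular matrices. *)
Definition is_cholesky (R : realType) (n : nat) (L A : 'M[R]_n) : Prop :=
  [/\ is_trig_mx L, forall i, 0 < L i i & L *m L^T = A].

(* [lne] is the extended logarithm, with value -oo at 0. *)
Definition ldet (R : realType) (n : nat) (A : 'M[R]_n) : \bar R :=
  lne (\det A)%:E.

(* The eigenvalues of [A] with multiplicity, in nonincreasing order.  The
   default value [::] is never taken when [A] is symmetric: see [eigvalsP].
   Indexing is from 0, so the i-th largest eigenvalue is [(eigvals A)`_i.-1]. *)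
Definition eigvals (R : realType) (n : nat) (A : 'M[R]_n) : seq R :=
  xget [::] [set s : seq R |
    sorted >=%R s /\ char_poly A = \prod_(a <- s) ('X - a%:P)].

Definition tailavg (R : realType) (t : nat) (lam : seq R) (i : nat) : R :=
  (\sum_(i <= l < size lam) lam`_l) / (t - i)%:R.

(* lambda_i > tailavg >= lambda_(i+1) with 1-based lambda; the first
   inequality is void for i = 0, where lambda_0 = +oo. *)
Definition breakpoint (R : realType) (t : nat) (lam : seq R) (i : nat) : bool :=
  ((i == 0)%N || (tailavg t lam i < lam`_i.-1)) && (lam`_i <= tailavg t lam i).

(* The unique breakpoint below [t]: see [breakpoint_uniq] and [phi_indexP]. *)
Definition phi_index (R : realType) (t : nat) (lam : seq R) : nat :=
  find (breakpoint t lam) (iota 0 t).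

Definition phi (R : realType) (t : nat) (lam : seq R) : \bar R :=
  let i := phi_index t lam in
  (\sum_(l < i) lne (lam`_l)%:E
   + (t - i)%:R%:E * lne (tailavg t lam i)%:E)%E.

Definition Gamma (R : realType) (n t : nat) (X : 'M[R]_n) : \bar R :=
  phi t (eigvals X).

Definition feasible (R : realType) (p t : nat) : set 'cV[R]_p :=
  [set z | \sum_i z i 0 = t%:R /\ forall i, 0 <= z i 0 <= 1].

(* [row i Psi] is the row vector psi_i^T.  The maximum is written as a supremum in
   the extended reals; it is attained, the objective being continuous (with
   values in [-oo, +oo[) on a compact set. *)
Definition Gamma_bound (R : realType) (p m t : nat)
    (B : 'M[R]_m) (Psi : 'M[R]_p) : \bar R :=
  (ldet B + ereal_sup
    [set Gamma t (\sum_(i < p) z i 0 *: ((row i Psi)^T *m row i Psi))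
    | z in @feasible R p t])%E.

Definition spectral_bound (R : realType) (p m t : nat)
    (G : 'M[R]_(p, m)) (B : 'M[R]_m) : \bar R :=
  (ldet B +
    \sum_(i < t) lne (1 + (eigvals (G *m invmx B *m G^T))`_i)%:E)%E.

Lemma eigvalsP (R : realType) (n : nat) (A : 'M[R]_n) : A^T = A ->
  sorted >=%R (eigvals A) /\ char_poly A = \prod_(a <- eigvals A) ('X - a%:P).
Proof.
move=> symA; rewrite /eigvals; case: xgetP => [_ -> //|noS]; exfalso.
pose C : numClosedFieldType := complex.complex R.
pose f : {rmorphism R -> C} := complex.real_complex R.
pose M : 'M[C]_n := map_mx f A.
have Mreal : M \is a mxOver Num.real.
  by apply/mxOverP => i j; rewrite mxE; apply/complex.complex_realP; exists (A i j).
have symM : M \is symmetricmx.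
  by apply/is_hermitianmxP; rewrite expr0 scale1r map_mx_id // /M map_trmx symA.
have hermM := realsym_hermsym symM Mreal.
have Dreal := hermitian_spectral_diag_real hermM.
have /orthomx_spectralP MPD := hermitian_normalmx hermM.
set P := spectralmx M in MPD; set D := spectral_diag M in MPD Dreal.
have Punit : P \in unitmx by exact: spectral_unit.
have cM : char_poly M = \prod_i ('X - (D 0 i)%:P).
  have -> : char_poly M = char_poly (diag_mx D).
    have PM : P *m M = diag_mx D *m P by rewrite {1}MPD !mulmxA mulmxV // mul1mx.
    have: map_mx polyC P *m char_poly_mx M = char_poly_mx (diag_mx D) *m map_mx polyC P.
      by rewrite /char_poly_mx mulmxBr mulmxBl -!map_mxM PM scalar_mxC.
    move/(congr1 determinant); rewrite !det_mulmx mulrC; apply: mulIf.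
    by rewrite det_map_mx polyC_eq0 -unitfE -unitmxE.
  rewrite char_poly_trig ?diag_mx_is_trig //.
  by apply: eq_bigr => i _; rewrite mxE eqxx mulr1n.
pose d i := complex.Re (D 0 i).
have fd i : f (d i) = D 0 i.
  by apply: complex.RRe_real; move/mxOverP: Dreal; exact.
pose s := sort >=%R [seq d i | i : 'I_n].
apply: (noS s); split; first by apply: sort_sorted => x y; exact: le_total.
apply: (map_poly_inj f); rewrite map_char_poly -/M cM rmorph_prod /=.
rewrite (perm_big [seq d i | i : 'I_n]) ?perm_sort // big_image /=.
by apply: eq_bigr => i _; rewrite rmorphB /= map_polyX map_polyC /= fd.
Qed.

Lemma size_eigvals (R : realType) (n : nat) (A : 'M[R]_n) : A^T = A ->
  size (eigvals A) = n.
Proof.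
move=> /eigvalsP[_ /(congr1 (fun q : {poly R} => size q))].
by rewrite size_char_poly size_prod_XsubC => -[].
Qed.

Section Breakpoint.
Variables (R : realType) (t : nat) (lam : seq R).
Hypotheses (lam_sorted : sorted >=%R lam) (lam_ge0 : all (>= 0) lam).
Hypothesis t_le : (t <= size lam)%N.

Let avg_le i : (i < t)%N -> (lam`_i <= tailavg t lam i) =
  (lam`_i * (t - i.+1)%:R <= \sum_(i.+1 <= l < size lam) lam`_l).
Proof.
move=> it; rewrite /tailavg ler_pdivlMr ?ltr0n ?subn_gt0 //.
rewrite big_ltn ?(leq_trans it) // -(subnSK it) -(addn1 (t - i.+1)) natrD.
by rewrite mulrDr mulr1 addrC lerD2l.
Qed.

Let avg_lt i : (i.+1 < t)%N ->
  (tailavg t lam i.+1 < lam`_i) = ~~ (lam`_i <= tailavg t lam i).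
Proof.
move=> it; rewrite avg_le ?(ltnW it) // -ltNge.
by rewrite ltr_pdivrMr ?ltr0n ?subn_gt0.
Qed.

Let avg_leS i : (i.+1 < t)%N -> lam`_i <= tailavg t lam i ->
  lam`_i.+1 <= tailavg t lam i.+1.
Proof.
move=> it le_i; apply: (@le_trans _ _ lam`_i).
  have gt_tr : transitive (>=%R : rel R) by move=> x y z /[swap]; exact: le_trans.
  by apply: (sorted_ltn_nth gt_tr 0 lam_sorted); rewrite ?inE ?(leq_trans _ t_le) // ltnW.
by rewrite leNgt avg_lt // negbK.
Qed.

Lemma breakpoint_uniq i j : (i < t)%N -> (j < t)%N ->
  breakpoint t lam i -> breakpoint t lam j -> i = j.
Proof.
suff H a b : (a < b < t)%N -> breakpoint t lam a -> ~~ breakpoint t lam b.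
  move=> it jt bi bj; case: (ltngtP i j) => // ij.
    by have := H i j; rewrite ij jt bj => /(_ isT bi).
  by have := H j i; rewrite ij it bi => /(_ isT bj).
move=> /andP[ab bt] /andP[_ le_a].
case: b ab bt => // b ab bt; rewrite /breakpoint /= avg_lt // negb_and negbK.
apply/orP; left.
have: (a <= b)%N by [].
elim: b bt {ab} => [|b IH] bt; first by rewrite leqn0 => /eqP <-.
rewrite leq_eqVlt => /predU1P[<- //|ab].
by apply: avg_leS; [exact: ltnW | apply: IH => //; exact: ltnW].
Qed.

Lemma phi_indexP : (0 < t)%N ->
  (phi_index t lam < t)%N /\ breakpoint t lam (phi_index t lam).
Proof.
move=> t0; suff hasb : has (breakpoint t lam) (iota 0 t).
  have lt_t : (phi_index t lam < t)%N by move: hasb; rewrite has_find size_iota.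
  by split=> //; have := nth_find 0%N hasb; rewrite nth_iota.
pose Q i := lam`_i <= tailavg t lam i.
have exQ : exists i, Q i && (i < t)%N.
  exists t.-1; rewrite prednK // leqnn andbT /Q avg_le prednK // subnn mulr0.
  rewrite big_seq; apply: sumr_ge0 => l; rewrite mem_index_iota => /andP[_ ll].
  exact: (allP lam_ge0) (mem_nth _ ll).
case: (ex_minnP exQ) => i /andP[Qi it] imin.
apply/hasP; exists i; first by rewrite mem_iota.
apply/andP; split=> //; case: i it Qi imin => // i it _ imin /=.
rewrite avg_lt //; apply/negP => Qi.
by have := imin i; rewrite /Q Qi (ltnW it) ltnn => /(_ isT).
Qed.

End Breakpoint.

(* Main.v *)
(** Write [t = s - q], [N = Psi^T Psi], which has the eigenvalues [mu_l] of
    [Psi Psi^T = I + G B^-1 G^T], and [X = Psi^T Diag(z) Psi] with eigenvalues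
    [lam_l].  Then [tr (X N^-1) = tr Diag(z) = t], whereas the von Neumann trace
    inequality gives [\sum_l lam_l / mu_l <= tr (X N^-1)].  In [phi_t lam], let
    [c] be [lam] with the entries between the breakpoint and [t] averaged out
    to [a] and the later ones replaced by 0: this moves mass of the tail to the
    indices below [t], where [1 / mu_l] is smallest, so
    [\sum_(l < t) c_l / mu_l <= \sum_l lam_l / mu_l <= t], and [ln x <= x - 1]
    yields [phi_t lam = \sum_(l < t) ln c_l <= \sum_(l < t) ln mu_l]. *)
Require Import Defs.
From mathcomp Require Import all_boot all_order all_algebra.
From mathcomp Require Import all_classical all_reals ereal exp.
From mathcomp Require Import perm complex ring.

Import Order.TTheory GRing.Theory Num.Theory.
Local Open Scope ring_scope.
Local Open Scope sesquilinear_scope.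

(** * The von Neumann trace inequality *)

(* Linear programming duality for the assignment problem: [u i + v j] is a
   dual feasible potential, tight on the diagonal. *)
Lemma rearrangement_doubly_stochastic (K : numDomainType) (n : nat)
    (S : 'M[K]_n) (d e : nat -> K) :
  (forall i j, 0 <= S i j) ->
  (forall i, \sum_j S i j = 1) -> (forall j, \sum_i S i j = 1) ->
  {in gtn n &, forall i j, (i <= j)%N -> d j <= d i} ->
  {in gtn n &, forall i j, (i <= j)%N -> e i <= e j} ->
  \sum_(i < n) d i * e i <= \sum_i \sum_j S i j * (d i * e j).
Proof.
move=> S0 Srow Scol dmon emon.
(* [v] is a discrete Stieltjes integral of [d] against [e]; tightness on the diagonal then forces
   [u]. The slack [d i * e j - (u i + v j)] becomes a sum, over the steps between [i] and [j], of
   products of two differences whose signs are known by monotonicity. *)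
pose v j := \sum_(0 <= k < j) d k.+1 * (e k.+1 - e k).
pose u i := d i * e i - v i.
have vB i j : (i <= j)%N -> v j - v i = \sum_(i <= k < j) d k.+1 * (e k.+1 - e k).
  by move=> ij; rewrite /v (big_cat_nat (leq0n i) ij) //= [X in X - _]addrC addrK.
have sub_dvB i j : (i <= j)%N ->
    d i * (e j - e i) - (v j - v i) = \sum_(i <= k < j) (d i - d k.+1) * (e k.+1 - e k)
    /\ d j * (e j - e i) - (v j - v i) = \sum_(i <= k < j) (d j - d k.+1) * (e k.+1 - e k).
  move=> ij; rewrite vB // -telescope_sumr // !mulr_sumr -!sumrB.
  by split; apply: eq_bigr => k _; rewrite mulrBl.
have uv i j : (i < n)%N -> (j < n)%N -> u i + v j <= d i * e j.
  move=> i_lt j_lt; rewrite -subr_ge0.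
  have -> : d i * e j - (u i + v j) = d i * (e j - e i) - (v j - v i) by rewrite /u; ring.
  have e_ge0 k : (k.+1 < n)%N -> 0 <= e k.+1 - e k.
    by move=> kn; rewrite subr_ge0 emon ?inE // ltnW.
  case: (leqP i j) => [ij|/ltnW ji].
    rewrite (sub_dvB _ _ ij).1 big_nat sumr_ge0 // => k /andP[ik kj].
    have kn : (k.+1 < n)%N by exact: leq_ltn_trans kj _.
    by rewrite mulr_ge0 ?e_ge0 // subr_ge0 dmon ?inE // leqW.
  have -> : d i * (e j - e i) - (v j - v i) = - (d i * (e i - e j) - (v i - v j)) by ring.
  rewrite (sub_dvB _ _ ji).2 -sumrN big_nat sumr_ge0 // => k /andP[jk ki].
  have kn : (k.+1 < n)%N by exact: leq_ltn_trans ki _.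
  by rewrite -mulNr opprB mulr_ge0 ?e_ge0 // subr_ge0 dmon ?inE.
(* Unit row and column sums turn the pairing of [S] with [u i + v j] into the sum of [u i + v i],
   which is the left-hand side. *)
apply: (@le_trans _ _ (\sum_i \sum_j S i j * (u i + v j))).
  rewrite [leRHS](_ : _ = \sum_(i < n) (u i + v i)).
    by rewrite (eq_bigr (fun i : 'I_n => u i + v i)) // => i _; rewrite /u subrK.
  under eq_bigr do (under eq_bigr do rewrite mulrDr; rewrite big_split /=).
  rewrite big_split /= [X in _ + X]exchange_big /= -big_split /=.
  by apply: eq_bigr => i _; rewrite -!mulr_suml Srow Scol !mul1r.
by apply: ler_sum => i _; apply: ler_sum => j _; apply: ler_wpM2l => //; exact: uv.
Qed.

Lemma conj_diag_mxE (C : numClosedFieldType) (m n : nat) (U : 'M[C]_(m, n))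
    (d : 'rV[C]_m) i j :
  (U^t* *m diag_mx d *m U) i j = \sum_k d 0 k * ((U k i)^* * U k j).
Proof.
rewrite mul_mx_diag mxE; apply: eq_bigr => k _.
by rewrite !mxE mulrCA mulrA.
Qed.

Lemma unitarymx_col_sum (C : numClosedFieldType) (n : nat) (U : 'M[C]_n) j :
  U \is unitarymx -> \sum_i `|U i j| ^+ 2 = 1.
Proof.
rewrite -trmxC_unitary => /unitarymxP/matrixP/(_ j j).
rewrite trmxCK !mxE eqxx mulr1n => <-.
by apply: eq_bigr => i _; rewrite !mxE normCKC.
Qed.

Lemma unitarymx_row_sum (C : numClosedFieldType) (n : nat) (U : 'M[C]_n) i :
  U \is unitarymx -> \sum_j `|U i j| ^+ 2 = 1.
Proof.
rewrite -trmx_unitary => /(unitarymx_col_sum _ _ _ i) <-.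
by apply: eq_bigr => j _; rewrite mxE.
Qed.

(** For [W = V *m U^t*], cyclicity of the trace gives [\tr (A *m B)] as the sum of
    [|W j i|^2 * d i * e j], and the squared moduli of the entries of a unitary matrix form a doubly
    stochastic matrix. Since [d] and [e] are oppositely ordered, the diagonal pairing is minimal. *)
Lemma trace_mul_ge (C : numClosedFieldType) (n : nat) (U V A B : 'M[C]_n)
    (d e : nat -> C) :
  U \is unitarymx -> V \is unitarymx ->
  A = U^t* *m diag_mx (\row_i d i) *m U ->
  B = V^t* *m diag_mx (\row_i e i) *m V ->
  {in gtn n &, forall i j, (i <= j)%N -> d j <= d i} ->
  {in gtn n &, forall i j, (i <= j)%N -> e i <= e j} ->
  \sum_(i < n) d i * e i <= \tr (A *m B).
Proof.
move=> Uu Vu -> -> dmon emon; pose W := V *m U^t*.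
have Wu : W \is unitarymx by rewrite mul_unitarymx ?trmxC_unitary.
have -> : \tr (U^t* *m diag_mx (\row_i d i) *m U *m (V^t* *m diag_mx (\row_i e i) *m V))
    = \tr (diag_mx (\row_i d i) *m (W^t* *m diag_mx (\row_i e i) *m W)).
  by rewrite /W trmx_mul map_mxM trmxCK -!mulmxA mxtrace_mulC !mulmxA.
have -> : \tr (diag_mx (\row_i d i) *m (W^t* *m diag_mx (\row_i e i) *m W))
    = \sum_i \sum_j (\matrix_(i, j) (`|W j i| ^+ 2)) i j * (d i * e j).
  apply: eq_bigr => i _; rewrite mul_diag_mx mxE mxE conj_diag_mxE mulr_sumr.
  by apply: eq_bigr => j _; rewrite !mxE normCKC; ring.
apply: rearrangement_doubly_stochastic => // [i j|i|j].
- by rewrite mxE exprn_ge0.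
- by under eq_bigr do rewrite mxE; exact: unitarymx_col_sum.
- by under eq_bigr do rewrite mxE; exact: unitarymx_row_sum.
Qed.

(** * Diagonalization with the eigenvalues in a prescribed order *)

Lemma char_poly_similar (K : fieldType) (n : nat) (P A B : 'M[K]_n) :
  P \in unitmx -> P *m A = B *m P -> char_poly A = char_poly B.
Proof.
move=> Pu PA.
have: map_mx polyC P *m char_poly_mx A = char_poly_mx B *m map_mx polyC P.
  by rewrite /char_poly_mx mulmxBr mulmxBl -!map_mxM PA scalar_mxC.
move/(congr1 determinant); rewrite !det_mulmx mulrC; apply: mulIf.
by rewrite det_map_mx polyC_eq0 -unitfE -unitmxE.
Qed.

(** The spectral theorem over the complex numbers lists the eigenvalues in an uncontrolled order.
    That list and [s] are the roots of the same split polynomial, so they differ by a permutation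
    [tau], which is absorbed by permuting the rows of the unitary matrix. *)
Lemma unitary_diagonalization (R : realType) (n : nat) (A : 'M[R]_n) (s : seq R) :
  A^T = A -> char_poly A = \prod_(a <- s) ('X - a%:P) ->
  exists2 U : 'M[R[i]]_n, U \is unitarymx &
    map_mx (real_complex R) A = U^t* *m diag_mx (\row_i (s`_i)%:C%C) *m U.
Proof.
move=> symA charA; pose f := real_complex R; set M := map_mx _ A.
have Mreal : M \is a mxOver Num.real.
  by apply/mxOverP => i j; rewrite mxE; apply/complex_realP; exists (A i j).
have symM : M \is symmetricmx.
  by apply/is_hermitianmxP; rewrite expr0 scale1r map_mx_id // /M map_trmx symA.
have /hermitian_normalmx/orthomx_spectralP MPD := realsym_hermsym symM Mreal.
have Pu := spectral_unitarymx M.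
set P := spectralmx M in MPD Pu; set D := spectral_diag M in MPD.
have size_s : size s = n.
  by have := size_char_poly A; rewrite charA size_prod_XsubC => -[].
have cM : char_poly M = \prod_(a <- [seq D 0 i | i : 'I_n]) ('X - a%:P).
  rewrite (@char_poly_similar _ _ P _ (diag_mx D)) ?unitarymx_unit //.
    rewrite char_poly_trig ?diag_mx_is_trig // big_image /=.
    by apply: eq_bigr => i _; rewrite mxE eqxx mulr1n.
  by rewrite {1}MPD !mulmxA mulmxV ?mul1mx // unitarymx_unit.
have : perm_eq [seq f a | a <- s] [tuple D 0 i | i < n].
  apply: prod_XsubC_eq; rewrite /= -[RHS]cM -map_char_poly charA rmorph_prod big_map.
  by apply: eq_bigr => a _; rewrite rmorphB /= map_polyX map_polyC.
case/tuple_permP => tau s_tau.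
exists (row_perm tau P).
  apply/unitarymxP/matrixP => i j; have /unitarymxP/matrixP/(_ (tau i) (tau j)) := Pu.
  rewrite !mxE (inj_eq perm_inj) => <-.
  by apply: eq_bigr => k _; rewrite !mxE.
rewrite [LHS]MPD invmx_unitary //; apply/matrixP => i j; rewrite !conj_diag_mxE.
rewrite (reindex_perm tau) /=; apply: eq_bigr => k _; rewrite !mxE; congr (_ * _).
rewrite -[RHS](nth_map 0 0 f) ?size_s // s_tau.
by rewrite -tnth_nth !tnth_mktuple.
Qed.

(** * Upper bound on [phi] under a weighted trace constraint *)

Lemma phi_le (R : realType) (t : nat) (lam : seq R) (mu : nat -> R) :
  sorted >=%R lam -> all (>= 0) lam -> (0 < t <= size lam)%N ->
  {in gtn (size lam), forall i, 0 < mu i} ->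
  {in gtn (size lam) &, forall i j, (i <= j)%N -> mu j <= mu i} ->
  \sum_(i < size lam) lam`_i / mu i <= t%:R ->
  (phi t lam <= \sum_(i < t) lne (mu i)%:E)%E.
Proof.
move=> lam_sorted lam_ge0 /andP[t_gt0 t_le] mu_gt0 mu_mono sum_le.
have lam_mono j l : (j <= l)%N -> (l < size lam)%N -> lam`_l <= lam`_j.
  move=> jl ls; have [<- //|jl'] := eqVneq j l.
  have gt_tr : transitive (>=%R : rel R) by move=> x y z /[swap]; exact: le_trans.
  apply: (sorted_ltn_nth gt_tr 0 lam_sorted); rewrite ?inE //.
    exact: leq_ltn_trans ls.
  by rewrite ltn_neqAle jl'.
have lam_nth_ge0 l : 0 <= lam`_l.
  by case: (ltnP l (size lam)) => [/(mem_nth 0)/(allP lam_ge0)|/(nth_default 0) ->].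
have [] := phi_indexP lam_ge0 t_le t_gt0.
rewrite /phi; set k := phi_index t lam => k_lt /andP[lt_k le_k].
set a := tailavg t lam k in lt_k le_k *.
have tk_gt0 : 0 < (t - k)%:R :> R by rewrite ltr0n subn_gt0.
have tail_sum : \sum_(k <= l < size lam) lam`_l = (t - k)%:R * a.
  by rewrite /a /tailavg mulrC divfK ?gt_eqF.
have a_ge0 : 0 <= a.
  by rewrite /a /tailavg divr_ge0 ?ler0n // sumr_ge0.
(* A zero tail average carries the positive weight [t - k], so [phi] is then [-oo]. Otherwise all
   the logarithms below are finite. *)
have [a0|a_neq0] := eqVneq a 0.
  by rewrite a0 le0_lneNy // gt0_muleNy ?lte_fin // addeNy leNye.
have a_gt0 : 0 < a by rewrite lt_def a_neq0.
pose c l := if (l < k)%N then lam`_l else if (l < t)%N then a else 0.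
have c_gt0 l : (l < t)%N -> 0 < c l.
  move=> lt; rewrite /c lt; case: ifP => // lk; apply: (lt_le_trans a_gt0).
  have k_gt0 : (0 < k)%N by exact: leq_ltn_trans lk.
  (* As [l < k], the breakpoint is not 0, so the convention on [lambda_0] is not in play and [a]
     lies strictly below the entry of index [k.-1]. *)
  move: lt_k; rewrite gtn_eqF //= => /ltW/le_trans; apply; apply: lam_mono.
    by rewrite -ltnS prednK.
  by rewrite prednK // (leq_trans _ t_le) // ltnW.
have -> : (\sum_(l < k) lne (lam`_l)%:E + (t - k)%:R%:E * lne a%:E =
    (\sum_(0 <= l < t) ln (c l))%R%:E)%E.
  rewrite (big_cat_nat (leq0n k) (ltnW k_lt)) // EFinD; congr (_ + _)%E.
    rewrite big_mkord -sumEFin; apply: eq_bigr => l _.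
    have lt : (l < t)%N by exact: ltn_trans k_lt.
    by have := c_gt0 l lt; rewrite /c ltn_ord => ?; rewrite lne_EFin.
  rewrite (eq_big_nat _ _ (F2 := fun=> ln a)) => [|l /andP[kl lt]].
    by rewrite sumr_const_nat lne_EFin // -EFinM mulr_natl.
  by rewrite /c ltnNge kl lt.
rewrite (eq_bigr (fun i : 'I_t => (ln (mu i))%:E)); last first.
  by move=> i _; rewrite lne_EFin // mu_gt0 // inE (leq_trans _ t_le).
rewrite sumEFin lee_fin -(big_mkord xpredT (fun i => ln (mu i))).
rewrite -subr_le0 -sumrB.
apply: (@le_trans _ _ (\sum_(0 <= l < t) (c l / mu l - 1))).
  apply: ler_sum_nat => l /andP[_ lt].
  have mul : 0 < mu l by rewrite mu_gt0 // inE (leq_trans _ t_le).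
  rewrite -ln_div ?posrE ?c_gt0 //.
  rewrite -[in leLHS](subrK 1 (c l / mu l)) addrC le_ln1Dx //.
  by rewrite ltrBrDr addNr divr_gt0 ?c_gt0.
rewrite sumrB sumr_const_nat subn0 subr_le0; apply: le_trans sum_le.
rewrite -(big_mkord xpredT (fun i => lam`_i / mu i)).
(* The [t - k] copies of [a] add up to exactly the tail they replace. *)
have c_sum : \sum_(0 <= l < size lam) c l = \sum_(0 <= l < size lam) lam`_l.
  have kt := ltnW k_lt; have ks := leq_trans kt t_le.
  rewrite !(big_cat_nat (leq0n k) ks) //=; congr (_ + _).
    by apply: eq_big_nat => l /andP[_ lk]; rewrite /c lk.
  rewrite tail_sum (big_cat_nat kt t_le) //= [X in _ + X]big_nat_cond.
  rewrite [X in _ + X]big1.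
    rewrite addr0 (eq_big_nat _ _ (F2 := fun=> a)) => [|l /andP[kl lt]].
      by rewrite sumr_const_nat mulr_natl.
    by rewrite /c ltnNge kl lt.
  move=> l /andP[/andP[tl _] _].
  by rewrite /c ltnNge (leq_trans kt tl) ltnNge tl.
have -> : \sum_(0 <= l < t) c l / mu l = \sum_(0 <= l < size lam) c l / mu l.
  rewrite [RHS](big_cat_nat (leq0n t) t_le) //= [X in _ + X]big_nat_cond.
  rewrite [X in _ + X]big1 ?addr0 // => l /andP[/andP[tl _] _].
  by rewrite /c ltnNge (leq_trans (ltnW k_lt) tl) ltnNge tl mul0r.
have pivot : (t.-1 < size lam)%N by rewrite prednK.
rewrite -subr_ge0 -sumrB.
(* Because [lam] and [c] have equal sums, the constant [(mu t.-1)^-1] may be subtracted from every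
   weight. Each term is then nonnegative: it vanishes before [k], both factors are nonpositive from
   [k] to [t.-1], and both are nonnegative from [t] on. *)
have -> : \sum_(0 <= l < size lam) (lam`_l / mu l - c l / mu l) =
    \sum_(0 <= l < size lam) (lam`_l - c l) * ((mu l)^-1 - (mu t.-1)^-1).
  under [RHS]eq_bigr do rewrite mulrBr.
  rewrite [RHS]sumrB -[X in _ = _ - X]mulr_suml [X in _ - X * _]sumrB c_sum subrr mul0r subr0.
  by apply: eq_bigr => l _; rewrite mulrBl.
rewrite big_nat sumr_ge0 // => l /andP[_ l_lt].
have mu_inv : (mu l)^-1 <= (mu t.-1)^-1 = (mu t.-1 <= mu l).
  by rewrite lef_pV2 // posrE mu_gt0.
have mu_inv' : (mu t.-1)^-1 <= (mu l)^-1 = (mu l <= mu t.-1).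
  by rewrite lef_pV2 // posrE mu_gt0.
rewrite /c; case: ltnP => lk; first by rewrite subrr mul0r.
case: ltnP => lt.
  rewrite mulr_le0 // subr_le0.
    by apply: le_trans le_k; exact: lam_mono.
  by rewrite mu_inv mu_mono // -ltnS prednK.
by rewrite subr0 mulr_ge0 // subr_ge0 mu_inv' mu_mono // (leq_trans (leq_pred _)).
Qed.

(** * Eigenvalues of semidefinite, shifted and inverted matrices *)

(** On an eigenvector [v] for [a], the quadratic form equals [a] times the positive squared norm of
    [v]. *)
Lemma psd_char_poly_roots_ge0 (R : realType) (n : nat) (A : 'M[R]_n) (s : seq R) :
  (forall v : 'rV_n, 0 <= (v *m A *m v^T) 0 0) ->
  char_poly A = \prod_(a <- s) ('X - a%:P) -> all (>= 0) s.
Proof.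
move=> A_ge0 charA; apply/allP => a a_s.
have : eigenvalue A a by rewrite eigenvalue_root_char charA root_prod_XsubC.
case/eigenvalueP => v vA v_neq0; have := A_ge0 v.
rewrite vA -scalemxAl mxE pmulr_lge0 // mxE.
have [k vk] : exists k, v 0 k != 0 by apply/rV0Pn.
rewrite (bigD1 k) //= ltr_wpDr ?sumr_ge0 // => [i _|]; rewrite mxE -expr2.
  exact: sqr_ge0.
by rewrite exprn_even_gt0.
Qed.

(** The characteristic matrix of [1%:M + A] is that of [A] with ['X - 1] substituted for ['X], and
    this substitution is a ring morphism, hence commutes with the determinant. *)
Lemma char_poly1D (R : realType) (n : nat) (A : 'M[R]_n) (s : seq R) :
  char_poly A = \prod_(a <- s) ('X - a%:P) ->
  char_poly (1%:M + A) = \prod_(a <- [seq 1 + a | a <- s]) ('X - a%:P).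
Proof.
move=> charA; pose shift : {rmorphism {poly R} -> {poly R}} := comp_poly ('X - 1).
have -> : char_poly (1%:M + A) = shift (char_poly A).
  rewrite /char_poly -det_map_mx; congr (\det _); apply/matrixP => i j.
  rewrite !mxE rmorphB /= rmorphMn /= /shift comp_polyX comp_polyC polyCD polyC_natr.
  by rewrite opprD addrA mulrnBl.
rewrite charA rmorph_prod big_map; apply: eq_bigr => a _.
by rewrite /= /shift comp_polyB comp_polyX comp_polyC polyCD opprD addrA.
Qed.

(** The matrix [V] that diagonalizes [N] also diagonalizes its inverse, with eigenvalues the
    reciprocals of [r]. These are nondecreasing, so [trace_mul_ge] applies over the complex numbers,
    and the result descends to the reals. *)
Lemma trace_mul_invmx_ge (R : realType) (n : nat) (A N : 'M[R]_n) (s r : seq R) :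
  A^T = A -> N^T = N ->
  char_poly A = \prod_(a <- s) ('X - a%:P) ->
  char_poly N = \prod_(a <- r) ('X - a%:P) ->
  sorted >=%R s -> sorted >=%R r -> all (> 0) r ->
  \sum_(i < n) s`_i / r`_i <= \tr (A *m invmx N).
Proof.
move=> symA symN charA charN s_sorted r_sorted r_gt0.
have size_char (M : 'M[R]_n) (q : seq R) : char_poly M = \prod_(a <- q) ('X - a%:P) -> size q = n.
  move=> charM; have := size_char_poly M.
  by rewrite charM size_prod_XsubC => -[].
have size_s := size_char _ _ charA; have size_r := size_char _ _ charN.
have [U Uu AE] := unitary_diagonalization _ _ _ _ symA charA.
have [V Vu NE] := unitary_diagonalization _ _ _ _ symN charN.
have r_pos i : (i < n)%N -> 0 < r`_i by move=> ilt; rewrite (allP r_gt0) // mem_nth ?size_r.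
have nonincr (q : seq R) i j : sorted >=%R q -> (i <= j < size q)%N -> q`_j <= q`_i.
  move=> q_sorted /andP[ij js]; apply: (sorted_leq_nth _ _ _ q_sorted) => //.
  - by move=> x y z /[swap]; exact: le_trans.
  - by move=> x; exact: lexx.
  - by rewrite inE (leq_ltn_trans ij).
have NVE : map_mx (real_complex R) (invmx N)
    = V^t* *m diag_mx (\row_i ((r`_i)^-1)%:C%C) *m V.
  rewrite map_invmx NE; set L := _ *m V; set L' := RHS.
  have L'L : L' *m L = 1%:M.
    rewrite /L' /L !mulmxA mulmxtVK // -(mulmxA (V^t*)) mulmx_diag.
    rewrite (_ : diag_mx _ = 1%:M) ?mulmx1; last first.
      apply/matrixP => i j; rewrite !mxE -rmorphM mulVf ?rmorph1 //.
      by rewrite gt_eqF ?r_pos.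
    by move: Vu; rewrite -trmxC_unitary => /unitarymxP; rewrite trmxCK.
  have [_ Lu] := mulmx1_unit L'L.
  by rewrite -[RHS](mulmxK Lu) L'L mul1mx.
rewrite -lecR (_ : (\tr _)%:C%C =
  \tr (map_mx (real_complex R) A *m map_mx (real_complex R) (invmx N))); last first.
  by rewrite -map_mxM trace_map_mx.
rewrite rmorph_sum; under eq_bigr do rewrite rmorphM /=.
apply: (trace_mul_ge _ _ _ _ _ _ (fun i => (s`_i)%:C%C)
  (fun i => ((r`_i)^-1)%:C%C) Uu Vu AE NVE) => i j.
  by rewrite !inE => ilt jlt ij; rewrite lecR nonincr ?ij ?size_s.
rewrite !inE => ilt jlt ij; rewrite lecR lef_pV2 ?posrE ?r_pos //.
by rewrite nonincr ?ij ?size_r.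
Qed.

(** * Comparison of the two bounds at each feasible point *)

Theorem theorem14 (R : realType) (p m q s : nat)
    (G : 'M[R]_(p, m)) (H : 'M[R]_(q, m)) (Psi : 'M[R]_p) :
  let B := H^T *m H in
  posdef B ->
  (1 <= s - q < p)%N ->
  is_cholesky Psi (1%:M + G *m invmx B *m G^T) ->
  (Gamma_bound (s - q) B Psi <= spectral_bound (s - q) G B)%E.
Proof.
move=> B _ /andP[t_gt0 t_lt]; set t := (s - q)%N in t_gt0 t_lt *.
set K := G *m _ *m _ => -[Psi_trig Psi_gt0 PsiE].
apply/leeD2l/ge_ereal_sup => _ [z [z_sum z01] <-].
have Psiu : Psi \in unitmx.
  by rewrite unitmxE unitfE det_trig //; apply/prodf_neq0 => i _; rewrite gt_eqF.
have symK : K^T = K.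
  (* Symmetry of [K] is read off from [K = Psi *m Psi^T - 1%:M]. *)
  rewrite -[K](addKr 1%:M) -PsiE.
  by rewrite linearD linearN /= trmx1 trmx_mul trmxK.
pose N := Psi^T *m Psi.
have symN : N^T = N by rewrite trmx_mul trmxK.
have Nu : N \in unitmx by rewrite unitmx_mul unitmx_tr Psiu.
set X := \sum_i _.
have XE : X = Psi^T *m diag_mx z^T *m Psi.
  apply/matrixP => i j; rewrite mul_mx_diag summxE mxE; apply: eq_bigr => k _.
  by rewrite !mxE big_ord1 !mxE mulrCA mulrA.
have symX : X^T = X by rewrite XE !trmx_mul trmxK tr_diag_mx mulmxA.
have [kap_sorted charK] := eigvalsP symK; have [lam_sorted charX] := eigvalsP symX.
have size_kap := size_eigvals symK; have size_lam := size_eigvals symX.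
pose mu := [seq 1 + a | a <- eigvals K].
have charN : char_poly N = \prod_(a <- mu) ('X - a%:P).
  (* [Psi] itself is the similarity: [Psi *m (Psi^T *m Psi) = (Psi *m Psi^T) *m Psi]. *)
  rewrite -(char_poly1D _ _ _ _ charK) -PsiE.
  by apply: (char_poly_similar _ _ Psi) => //; rewrite mulmxA.
(* Taken at [z] for [X] and at the all-ones vector for [N]. *)
have quadE (d v : 'rV[R]_p) : (v *m (Psi^T *m diag_mx d *m Psi) *m v^T) 0 0
    = \sum_i d 0 i * (v *m Psi^T) 0 i ^+ 2.
  rewrite !mulmxA -mulmxA -[Psi in X in _ *m X]trmxK -trmx_mul mul_mx_diag mxE.
  by apply: eq_bigr => i _; rewrite !mxE; ring.
have lam_ge0 : all (>= 0) (eigvals X).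
  apply: psd_char_poly_roots_ge0 charX => v; rewrite XE quadE sumr_ge0 // => i _.
  by rewrite mxE mulr_ge0 ?sqr_ge0 //; case/andP: (z01 i).
have mu_gt0 : all (> 0) mu.
  have mu_ge0 : all (>= 0) mu.
    apply: psd_char_poly_roots_ge0 charN => v; rewrite /N -[Psi^T]mulmx1 -diag_const_mx quadE.
    by apply: sumr_ge0 => i _; rewrite mxE mul1r sqr_ge0.
  (* Strict positivity: a zero eigenvalue would contradict the invertibility of [N]. *)
  apply/allP => a a_mu; rewrite lt_def (allP mu_ge0) // andbT.
  apply/eqP => a0; have : eigenvalue N 0.
    by rewrite eigenvalue_root_char charN root_prod_XsubC -a0.
  case/eigenvalueP => v; rewrite scale0r => vN /eqP; apply.
  by rewrite -[v](mulmxK Nu) vN mul0mx.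
have mu_sorted : sorted >=%R mu.
  by apply: homo_sorted kap_sorted => x y; rewrite /= lerD2l.
have trXN : \tr (X *m invmx N) = t%:R.
  have NVE : invmx N = invmx Psi *m invmx Psi^T.
    apply: (can_inj (mulKmx Nu)).
    by rewrite mulmxV // /N mulmxA mulmxK // mulmxV ?unitmx_tr.
  rewrite -z_sum XE NVE mulmxA mulmxK // mxtrace_mulC mulmxA.
  rewrite mulVmx ?unitmx_tr // mul1mx mxtrace_diag.
  by apply: eq_bigr => i _; rewrite mxE.
(* The bound [t < p] matters here: past the end of the lists, the default value 0 would give 1 on
   the left and 0 on the right. *)
have -> : (\sum_(i < t) lne (1 + (eigvals K)`_i)%:E = \sum_(i < t) lne (mu`_i)%:E)%E.
  by apply: eq_bigr => i _; rewrite (nth_map 0) // size_kap (ltn_trans _ t_lt).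
apply: phi_le => //.
- by rewrite t_gt0 size_lam ltnW.
- move=> i; rewrite inE size_lam => ilt; rewrite (allP mu_gt0) //.
  by rewrite mem_nth // size_map size_kap.
- move=> i j; rewrite !inE size_lam => ilt jlt ij.
  apply: (sorted_leq_nth _ _ _ mu_sorted) => //; rewrite ?inE ?size_map ?size_kap //.
    by move=> x y w /[swap]; exact: le_trans.
  by move=> x; exact: lexx.
- rewrite -trXN size_lam; exact: trace_mul_invmx_ge.
Qed.
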